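(* Let $A$ be an expanding $d\times d$ matrix with integer entries, let $q=|\det A|$, and let $w$ be a pseudo-norm on $\mathbb{R}^d$ associated with $A$. Let $E,F\subset\mathbb{R}^d$. Suppose the eigenvalues of $A$ have equal moduli. If $E\simeq_w F$ (i.e. $E$ and $F$ are $w$-Lipschitz equivalent), then $E\simeq_n F$ (i.e. $E$ and $F$ are nearly Lipschitz equivalent).
   Context: A $d\times d$ matrix is expanding if all its eigenvalues have modulus strictly greater than $1$. $\|\cdot\|$ is the Euclidean norm. Pseudo-norm: write $B_r$ for the open ball in $\mathbb{R}^d$ with center $0$ and radius $r$. Fix $0<\delta<1/2$ and a $C^\infty$ function $\varphi\ge 0$ supported in $B_{\delta}$ with $\varphi(x)=\varphi(-x)$ and $\int_{\mathbb{R}^d}\varphi=1$. Let $V=AB_1\setminus B_1$, $h=\chi_V*\varphi$ (convolution of the indicator function of $V$ with $\varphi$), and $$w(x)=\sum_{n=-\infty}^{\infty}q^{-n/d}h(A^nx),\quad x\in\mathbb{R}^d.$$ Then: (1) $w(x)=w(-x)$, and $w(x)=0$ iff $x=0$; (2) $w(Ax)=q^{1/d}w(x)$; (3) there is $\beta>0$ with $w(x+y)\le\beta\max\{w(x),w(y)\}$ for all $x,y$. $E\simeq_w F$ means: there exist a bijection $\sigma:E\to F$ and a constant $C>0$ such that $C^{-1}w(x-y)\le w(\sigma(x)-\sigma(y))\le C\,w(x-y)$ for all $x,y\in E$. $E\simeq_n F$ means: for every $0<\eta<1$ there exist a bijection $\sigma:E\to F$ and a constant $C>0$ such that $C^{-1}\|x-y\|^{1/\eta}\le\|\sigma(x)-\sigma(y)\|\le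 C\|x-y\|^{\eta}$ for all $x,y\in E$.
   Formalization: E is assumed bounded, since an unbounded E is nearly Lipschitz equivalent to no set, not even itself, though E ≃_w E; and w(x)=0 iff x=0 is required of the pseudo-norm, since it can fail for some A and φ in the stated construction. *)

(* Defs.v *)
From HB Require Import structures.
From mathcomp Require Import all_boot all_order all_algebra.
From mathcomp Require Import complex.
From mathcomp Require Import all_classical all_reals all_analysis.

Set Implicit Arguments.
Unset Strict Implicit.
Unset Printing Implicit Defensive.

Import Order.TTheory GRing.Theory Num.Theory.
Import numFieldNormedType.Exports.

Local Open Scope classical_set_scope.
Local Open Scope ring_scope.

Section LebesgueMeasure.
Variable R : realType.

Definition tcons n (p : R * n.-tuple R) : n.+1.-tuple R :=
  [tuple of p.1 :: p.2].

Lemma measurable_tcons n : measurable_fun [set: R * n.-tuple R] (@tcons n).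
Proof. exact: measurable_cons. Qed.

Section Step.
Variables (n : nat) (mu : {measure set (n.-tuple R) -> \bar R}).

(* Product of the measure on the line with mu, carried over to R^(n+1). *)
Definition lebesgue_step : set (n.+1.-tuple R) -> \bar R :=
  pushforward (@lebesgue_measure R \x^ mu)%E (@tcons n).

Let lebesgue_step0 : lebesgue_step set0 = 0%E.
Proof. by rewrite /lebesgue_step /pushforward preimage_set0 measure0. Qed.

Let lebesgue_step_ge0 A : (0 <= lebesgue_step A)%E.
Proof. exact: integral_ge0. Qed.

Let lebesgue_step_sigma_additive : semi_sigma_additive lebesgue_step.
Proof.
move=> F mF tF mUF; rewrite /lebesgue_step /pushforward preimage_bigcup.
have mG A : measurable A -> measurable (@tcons n @^-1` A).
  by move=> mA; rewrite -[X in measurable X]setTI; exact: measurable_tcons.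
apply: measure_semi_sigma_additive.
- by move=> k; exact: mG.
- apply/trivIsetP => /= i j _ _ ij; rewrite -preimage_setI.
  by move/trivIsetP : tF => /(_ _ _ _ _ ij) ->//; rewrite preimage_set0.
- by rewrite -preimage_bigcup; exact: mG.
Qed.

HB.instance Definition _ := isMeasure.Build _ _ _ lebesgue_step
  lebesgue_step0 lebesgue_step_ge0 lebesgue_step_sigma_additive.

End Step.

(* n-dimensional Lebesgue measure *)
Fixpoint lebesgue_tuple n : {measure set (n.-tuple R) -> \bar R} :=
  if n is m.+1 then lebesgue_step (lebesgue_tuple m) else dirac [tuple].

Lemma lebesgue_tuple_box n (A : 'I_n -> set R) :
  (forall i, measurable (A i)) ->
  lebesgue_tuple n [set t | forall i, A i (tnth t i)] =
  (\prod_(i < n) lebesgue_measure (A i))%E.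
Proof.
have mbox m (B : 'I_m -> set R) : (forall i, measurable (B i)) ->
    measurable [set t : m.-tuple R | forall i, B i (tnth t i)].
  move=> mB; rewrite [X in measurable X](_ : _ =
    \bigcap_(i in [set: 'I_m]) ((@tnth m R ^~ i) @^-1` B i)); last first.
    by apply/seteqP; split=> t /= Bt i; [move=> _|]; exact: Bt.
  apply: fin_bigcap_measurable => [|i _]; first exact: finite_finset.
  by rewrite -[X in measurable X]setTI; exact: measurable_tnth.
elim: n A => [|n IHn] A mA.
  by rewrite big_ord0/= diracE mem_set// => -[].
rewrite big_ord_recl -IHn; last by move=> i; exact: mA.
have mAn : measurable [set t : n.-tuple R | forall i, A (lift ord0 i) (tnth t i)].
  by apply: (mbox n (fun i => A (lift ord0 i))) => i; exact: mA.
rewrite -(product_measure2E lebesgue_measure (lebesgue_tuple n) (mA ord0) mAn).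
congr (product_measure2 _ _ _); apply/seteqP; split=> [[x t]|[x t]] /=.
  move=> At; split=> [|i]; first by have := At ord0; rewrite (tnth_nth 0).
  by have := At (lift ord0 i); rewrite !(tnth_nth 0).
move=> [Ax At] i; case: (unliftP ord0 i) => [j|] ->.
  by have := At j; rewrite !(tnth_nth 0).
by rewrite (tnth_nth 0).
Qed.

End LebesgueMeasure.

Section Euclidean.
Variables (R : realType) (d : nat).
Implicit Types (x y : 'cV[R]_d.+1) (phi : 'cV[R]_d.+1 -> R).

(* The library norm on matrices is the sup norm. *)
Definition enorm x : R := Num.sqrt (\sum_i x i 0 ^+ 2).

Definition eball (r : R) : set 'cV[R]_d.+1 := [set x | enorm x < r].

Definition integral_cV (f : 'cV[R]_d.+1 -> \bar R) : \bar R :=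
  (\int[@lebesgue_tuple R d.+1]_t f (\col_i tnth t i))%E.

Definition iter_partial (s : seq 'I_d.+1) phi : 'cV[R]_d.+1 -> R :=
  foldr (fun i g => 'D_(delta_mx i 0) g) phi s.

(* All partial derivatives of all orders exist and are continuous; derivability
   is explicit because ['D_v] is total. *)
Definition smooth phi : Prop :=
  forall s : seq 'I_d.+1, continuous (iter_partial s phi) /\
    forall i x, derivable (iter_partial s phi) x (delta_mx i 0).

Definition supp phi : set 'cV[R]_d.+1 := closure [set x | phi x != 0].

Definition convolution (f g : 'cV[R]_d.+1 -> R) x : \bar R :=
  integral_cV (fun y => (f y * g (x - y))%:E).

End Euclidean.

Section PseudoNorm.
Variables (R : realType) (d : nat).
Implicit Types (A : 'M[int]_d.+1) (phi w : 'cV[R]_d.+1 -> R).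

Definition is_eigenvalue A (z : R[i]) : bool :=
  eigenvalue (map_mx intr A : 'M[R[i]]_d.+1) z.

Definition expanding A : Prop := forall z, is_eigenvalue A z -> 1 < `|z|.

Definition equal_moduli A : Prop :=
  forall z1 z2, is_eigenvalue A z1 -> is_eigenvalue A z2 -> `|z1| = `|z2|.

Definition real_mx A : 'M[R]_d.+1 := map_mx intr A.

Definition annulus A : set 'cV[R]_d.+1 :=
  [set real_mx A *m x | x in eball 1] `\` eball 1.

Definition bump A phi (x : 'cV[R]_d.+1) : \bar R :=
  convolution \1_(annulus A) phi x.

Definition pseudo_norm_series A phi (x : 'cV[R]_d.+1) : \bar R :=
  let q : R := (`|\det A|%N)%:R in
  (\esum_(n in [set: int])
     ((q `^ (- (n%:~R / d.+1%:R)))%:E * bump A phi (real_mx A ^ n *m x)))%E.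

(* Definiteness is kept as a clause: it does not follow from the construction
   when B_1 is not contained in A B_1 and phi vanishes near 0 (an orbit of A may
   then miss the positivity set of the bump), while evenness, homogeneity and
   the quasi-triangle inequality are consequences of the clauses below. *)
Definition pseudo_norm A w : Prop :=
  exists (delta : R) (phi : 'cV[R]_d.+1 -> R),
    [/\ 0 < delta < 2^-1,
        [/\ smooth phi, forall x, 0 <= phi x,
            supp phi `<=` eball delta, forall x, phi x = phi (- x) &
            integral_cV (EFin \o phi) = 1%E],
        forall x, (w x)%:E = pseudo_norm_series A phi x &
        forall x, w x = 0 <-> x = 0].

Definition w_equivalent w (E F : set 'cV[R]_d.+1) : Prop :=
  exists (sigma : 'cV[R]_d.+1 -> 'cV[R]_d.+1) (C : R),
    [/\ set_bij E F sigma, 0 < C &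
      forall x y, E x -> E y ->
        C^-1 * w (x - y) <= w (sigma x - sigma y) <= C * w (x - y)].

(* Since eta < 1 < 1/eta, the two bounds are incompatible at large distances: an
   unbounded set is not nearly equivalent to any set, not even to itself. *)
Definition nearly_equivalent (E F : set 'cV[R]_d.+1) : Prop :=
  forall eta : R, 0 < eta < 1 ->
  exists (sigma : 'cV[R]_d.+1 -> 'cV[R]_d.+1) (C : R),
    [/\ set_bij E F sigma, 0 < C &
      forall x y, E x -> E y ->
        C^-1 * enorm (x - y) `^ eta^-1 <= enorm (sigma x - sigma y)
          <= C * enorm (x - y) `^ eta].

End PseudoNorm.

(* Main.v *)
Require Import Defs.
From mathcomp Require Import all_boot all_order all_algebra.
From mathcomp Require Import complex.
From mathcomp Require Import all_classical all_reals all_analysis.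
From mathcomp Require Import ring lra.

Set Implicit Arguments.
Unset Strict Implicit.
Unset Printing Implicit Defensive.

Import Order.TTheory GRing.Theory Num.Theory.
Import numFieldNormedType.Exports.
Import HBNNSimple.

Local Open Scope classical_set_scope.
Local Open Scope ring_scope.

(** Let B be the real matrix of A and rho the common modulus of its eigenvalues,
so that rho > 1 and rho ^ (d+1) = q.  Two facts carry the proof.

Since the series defining w runs over all integers, shifting it by one gives
w (B x) = rho * w x; and on every annulus r <= |v| <= r' with r > 0 the function
w lies between two positive constants.  Above, because the bump is bounded and
vanishes near 0 and far from 0, so that only finitely many terms of the series
matter on the annulus; below, because w is positive off 0, a positive value of
the bump persists, up to a constant factor, near the point where it is taken,
and the annulus is compact ([pseudo_norm_annulus]).

Since all eigenvalues of B have modulus rho, for every epsilon > 0 the norms of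
B ^ n and B ^ (- n) are O((rho + epsilon) ^ n) and O((1 / rho + epsilon) ^ n).
This follows from the Cayley-Hamilton theorem, by removing the linear factors of
the characteristic polynomial one at a time ([pow_mulmx_le]).

Any nonzero x in a given ball is B ^ (- n) v, with n >= 0 and v in a fixed
annulus.  Then w x is comparable to rho ^ (- n), while |x| lies between multiples
of rho ^ (- n (1 + s)) and rho ^ (- n (1 - s)) for any chosen s > 0.  Hence on
bounded sets w ^ (1 + s) <= C |x| and |x| <= C w ^ (1 - s) ([w_norm_hoelder]).
A map that is bi-Lipschitz for w is therefore bi-Hoelder for the norm, with
exponents eta = (1 - s) / (1 + s) and 1 / eta; any eta in (0, 1) arises this way.
Boundedness of E bounds w on the differences of E, hence on those of F, and a
bound on w bounds the norm ([norm_le_of_w_le]), so both sides fall under the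
local comparison. *)

(** * Powers of a matrix and moduli of its eigenvalues *)

(** The constant K' solves |z| K' + K <= a K', which is what the induction step
asks for. *)
Lemma le_geometric_recurrence (C : numFieldType) (u : nat -> C) (z a K : C) :
  `|z| < a -> (forall n, `|u n.+1 - z * u n| <= K * a ^+ n) ->
  exists K', forall n, `|u n| <= K' * a ^+ n.
Proof.
move=> za uK; have a0 : 0 < a := le_lt_trans (normr_ge0 _) za.
have K0 : 0 <= K by have := le_trans (normr_ge0 _) (uK 0%N); rewrite expr0 mulr1.
have az0 : 0 < a - `|z| by rewrite subr_gt0.
exists (`|u 0%N| + K / (a - `|z|)); elim=> [|n IHn].
  by rewrite expr0 mulr1 lerDl divr_ge0// ltW.
rewrite -[u n.+1](subrK (z * u n)); apply: le_trans (ler_normD _ _) _.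
have {IHn} : `|z * u n| <= `|z| * ((`|u 0%N| + K / (a - `|z|)) * a ^+ n).
  by rewrite normrM ler_wpM2l.
move=> /(lerD (uK n)) /le_trans; apply.
rewrite exprS mulrCA !mulrA -mulrDl ler_wpM2r ?exprn_ge0 ?(ltW a0)//.
rewrite -lerBrDr -mulrBr mulrC mulrDr mulrC.
rewrite -[X in _ + X]mulrC divfK ?gt_eqF// lerDr.
by rewrite mulr_ge0 // ltW.
Qed.

(** The generalization over P makes the induction on the list of roots work: with
Q = P (M - z), one has P M^(n+1) - z P M^n = Q M^n, so a bound for Q gives a
first-order recurrence with ratio z for P, and |z| < a. *)
Lemma pow_mx_entry_le (C : numFieldType) d (M : 'M[C]_d.+1) (a : C) (s : seq C)
    (P : 'M[C]_d.+1) i j :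
  {in s, forall z, `|z| < a} -> P * \prod_(z <- s) (M - z%:M) = 0 ->
  exists K, forall n, `|(P * M ^+ n) i j| <= K * a ^+ n.
Proof.
elim: s P => [|z s IHs] P sa.
  rewrite big_nil mulr1 => ->.
  by exists 0 => n; rewrite mul0r mxE normr0 mul0r.
rewrite big_cons mulrA => /IHs[x xs|K PK]; first by apply: sa; rewrite in_cons xs orbT.
apply: (@le_geometric_recurrence _ _ z _ K) => [|n].
  by apply: sa; exact: mem_head.
suff -> : (P * M ^+ n.+1) i j - z * (P * M ^+ n) i j =
          (P * (M - z%:M) * M ^+ n) i j by [].
rewrite mulrBr mulrBl -mulrA -exprS.
by rewrite -[P * z%:M]/(P *m z%:M) mul_mx_scalar -scalerAl !mxE.
Qed.

Lemma char_poly_roots (F : closedFieldType) d (M : 'M[F]_d.+1) :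
  exists s : seq F, [/\ char_poly M = \prod_(z <- s) ('X - z%:P), size s = d.+1 &
    {in s, forall z, eigenvalue M z}].
Proof.
have [s sE] := closed_field_poly_normal (char_poly M).
rewrite (monicP (char_poly_monic M)) scale1r in sE.
exists s; split=> //.
  by apply: succn_inj; rewrite -(size_prod_XsubC s id) -sE size_char_poly.
by move=> z zs; rewrite eigenvalue_root_char sE root_prod_XsubC.
Qed.

Lemma det_norm_eigenvalues (C : numClosedFieldType) d (M : 'M[C]_d.+1) r :
  (forall z, eigenvalue M z -> `|z| = r) -> `|\det M| = r ^+ d.+1.
Proof.
move=> Mr; have [s [sE ss sM]] := char_poly_roots M; rewrite -[in RHS]ss.
have : `|(char_poly M)`_0| = `|\det M|.
  by rewrite char_poly_det normrM normrX normrN1 expr1n mul1r.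
rewrite -horner_coef0 sE horner_prod normr_prod => <-.
rewrite (eq_big_seq (fun=> r)) => [|z /sM/Mr <-].
  by rewrite big_const_seq count_predT iter_mulr_1.
by rewrite hornerXsubC sub0r normrN.
Qed.

(** By Cayley-Hamilton the product of the factors M - z over the roots of the
characteristic polynomial is 0, which starts the descent with P = 1. *)
Lemma pow_mx_le (C : numClosedFieldType) d (M : 'M[C]_d.+1) (a : C) i j :
  (forall z, eigenvalue M z -> `|z| < a) ->
  exists K, forall n, `|(M ^+ n) i j| <= K * a ^+ n.
Proof.
move=> Ma; have [s [sE _ sM]] := char_poly_roots M.
have := Cayley_Hamilton M; rewrite sE rmorph_prod /= => M0.
have [||K MK] := @pow_mx_entry_le _ _ M a s 1 i j; first by move=> z /sM/Ma.
  rewrite mul1r -[RHS]M0; apply: eq_bigr => z _.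
  by rewrite rmorphB /= horner_mx_X horner_mx_C.
by exists K => n; rewrite -[M ^+ n]mul1r; exact: MK.
Qed.

(** * The sup norm, the Euclidean norm and matrix products *)

Section SupNorm.
Variables (R : realType) (d : nat).
Implicit Types (x v : 'cV[R]_d.+1) (B : 'M[R]_d.+1).

Lemma entry_le_norm x i : `|x i 0| <= `|x|.
Proof.
rewrite [leRHS]/Num.Def.normr /= mx_normrE.
by apply: (@le_bigmax _ _ _ 0 (fun ij : 'I_d.+1 * 'I_1 => `|x ij.1 ij.2|) (i, 0)).
Qed.

Lemma norm_le_entries x (c : R) :
  0 <= c -> (forall i, `|x i 0| <= c) -> `|x| <= c.
Proof.
move=> c0 xc; rewrite [leLHS]/Num.Def.normr /= mx_normrE.
by apply/bigmax_leP; split=> // -[i j] _ /=; rewrite ord1; exact: xc.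
Qed.

Lemma norm_mulmx_le (B : 'M[R]_d.+1) (c : R) x :
  (forall i j, `|B i j| <= c) -> `|B *m x| <= d.+1%:R * c * `|x|.
Proof.
move=> Bc; have c0 : 0 <= c := le_trans (normr_ge0 _) (Bc 0 0).
apply: norm_le_entries => [|i]; first by rewrite !mulr_ge0.
rewrite mxE; apply: le_trans (ler_norm_sum _ _ _) _.
apply: (@le_trans _ _ (\sum_(j < d.+1) c * `|x|)).
  by apply: ler_sum => j _; rewrite normrM ler_pM// entry_le_norm.
by rewrite sumr_const card_ord -[leLHS]mulr_natl mulrA.
Qed.

Lemma mulmx_bounded B : exists2 c : R, 0 < c & forall x, `|B *m x| <= c * `|x|.
Proof.
exists (d.+1%:R * (1 + \sum_i \sum_j `|B i j|)) => [|x].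
  by rewrite mulr_gt0// ltr_pwDl// sumr_ge0// => i _; rewrite sumr_ge0.
apply: norm_mulmx_le => i j; rewrite (bigD1 i)//= (bigD1 j)//= addrCA -addrA lerDl.
by rewrite !addr_ge0// ?sumr_ge0// => k _; rewrite sumr_ge0.
Qed.

Lemma enorm_sqr_ge0 x : 0 <= \sum_i x i 0 ^+ 2.
Proof. by apply: sumr_ge0 => i _; exact: sqr_ge0. Qed.

Lemma norm_le_enorm x : `|x| <= enorm x.
Proof.
apply: norm_le_entries => [|i]; first exact: sqrtr_ge0.
rewrite -sqrtr_sqr ler_wsqrtr// (bigD1 i)//= lerDl.
by apply: sumr_ge0 => j _; exact: sqr_ge0.
Qed.

Lemma enorm_le_norm x : enorm x <= d.+1%:R * `|x|.
Proof.
rewrite -(ger0_norm (_ : 0 <= d.+1%:R * `|x|)) ?mulr_ge0// -sqrtr_sqr ler_wsqrtr//.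
apply: (@le_trans _ _ (\sum_(i < d.+1) `|x| ^+ 2)).
  by apply: ler_sum => i _; rewrite -real_normK ?num_real// lerXn2r ?nnegrE// entry_le_norm.
rewrite sumr_const card_ord -[leLHS]mulr_natl exprMn ler_wpM2r ?sqr_ge0//.
by rewrite expr2 ler_peMr// ler1n.
Qed.

(** The entrywise bound holds over the complex numbers; its constants are
nonnegative complex numbers, hence real, and can be used over R. *)
Lemma pow_mulmx_le B (r a : R) :
  (forall z : R[i], eigenvalue (map_mx (real_complex R) B) z ->
     `|z| = (r%:C)%C) -> r < a ->
  exists2 c : R, 0 < c & forall n x, `|B ^+ n *m x| <= c * a ^+ n * `|x|.
Proof.
move=> Br ra; pose M := map_mx (real_complex R) B.
have Ma z : eigenvalue M z -> `|z| < (a%:C)%C by move=> /Br ->; rewrite ltcR.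
have entry i j : exists K : R, forall n, `|(B ^+ n) i j| <= K * a ^+ n.
  have [K MK] := pow_mx_le i j Ma.
  have K0 : 0 <= K by have := le_trans (normr_ge0 _) (MK 0%N); rewrite expr0 mulr1.
  exists (complex.Re K) => n.
  have /RRe_real KE : K \is Num.real by exact: ger0_real.
  have := MK n.
  have -> : K * (a%:C)%C ^+ n = (complex.Re K * a ^+ n)%:C%C.
    by rewrite rmorphM rmorphXn /= KE.
  have -> : (M ^+ n) i j = ((B ^+ n) i j)%:C%C by rewrite /M -rmorphXn mxE.
  by rewrite normc_def /= expr0n addr0 sqrtr_sqr lecR.
have [K BK] : exists K : 'I_d.+1 -> 'I_d.+1 -> R,
    forall i j n, `|(B ^+ n) i j| <= K i j * a ^+ n.
  have /choice[K BK] : forall ij, exists K : R, forall n,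
      `|(B ^+ n) ij.1 ij.2| <= K * a ^+ n by move=> ij; exact: entry.
  by exists (fun i j => K (i, j)) => i j; exact: (BK (i, j)).
have a0 : 0 < a.
  have [s [_ ss sM]] := char_poly_roots M.
  case: s ss sM => // z s _ /(_ z (mem_head _ _)) /Ma.
  by move=> /(le_lt_trans (normr_ge0 _)); rewrite -(rmorph0 (real_complex R)) ltcR.
pose c := 1 + \sum_i \sum_j `|K i j|.
exists (d.+1%:R * c) => [|n x].
  by rewrite mulr_gt0// ltr_pwDl// sumr_ge0// => i _; rewrite sumr_ge0.
rewrite -(mulrA _ c).
apply: norm_mulmx_le => i j; apply: le_trans (BK i j n) _.
rewrite ler_wpM2r ?exprn_ge0 ?(ltW a0)//; apply: le_trans (ler_norm _) _.
rewrite /c (bigD1 i)//= (bigD1 j)//= addrCA -addrA lerDl.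
by rewrite !addr_ge0// ?sumr_ge0// => k _; rewrite sumr_ge0.
Qed.

End SupNorm.

(** * The dilation B: norms of iterates *)

Section Spectrum.
Variables (R : realType) (d : nat).
Implicit Types (A : 'M[int]_d.+1) (B : 'M[R]_d.+1).

Lemma eigenvalue_real_mx A (z : R[i]) :
  eigenvalue (map_mx (real_complex R) (real_mx R A)) z = is_eigenvalue A z.
Proof.
rewrite /is_eigenvalue /real_mx; congr (eigenvalue _ z).
by apply/matrixP => i j; rewrite !mxE rmorph_int.
Qed.

Lemma eigenvalueV (F : fieldType) (M : 'M[F]_d.+1) z : M \is a GRing.unit ->
  eigenvalue M^-1 z -> eigenvalue M z^-1.
Proof.
move=> Mu /eigenvalueP[v vM v0]; apply/eigenvalueP; exists v => //.
have vE : v = z *: (v *m M) by rewrite scalemxAl -vM -mulmxA [_ *m M]mulVr// mulmx1.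
have z0 : z != 0 by apply: contraNneq v0 => z0; rewrite vE z0 scale0r.
by rewrite {2}vE scalerA mulVf// scale1r.
Qed.

(** The determinant is the product of the d+1 eigenvalues, hence the equation
between rho and q; it is not 0 since the eigenvalues are not. *)
Lemma common_modulus A : expanding R A -> equal_moduli R A ->
  exists rho : R, [/\ 1 < rho, rho ^+ d.+1 = (`|\det A|%N)%:R,
    real_mx R A \is a GRing.unit &
    forall z, eigenvalue (map_mx (real_complex R) (real_mx R A)) z ->
      `|z| = rho%:C%C].
Proof.
move=> expA eqA; pose M := map_mx (real_complex R) (real_mx R A).
have [s [_ ss sM]] := char_poly_roots M.
case: s ss sM => // z0 s _ /(_ z0 (mem_head _ _)); rewrite eigenvalue_real_mx => Az0.
have /RRe_real rE : `|z0| \is Num.real by exact: ger0_real.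
pose rho := complex.Re `|z0|; have {}rE : rho%:C%C = `|z0| := rE.
have Arho z : eigenvalue M z -> `|z| = rho%:C%C.
  by rewrite eigenvalue_real_mx rE => Az; exact: eqA.
have rho1 : 1 < rho by rewrite -ltcR rE; exact: expA.
have detM := det_norm_eigenvalues Arho.
have detA : rho ^+ d.+1 = (`|\det A|%N)%:R.
  apply: (@complexI R); rewrite rmorphXn/= -detM /M det_map_mx /real_mx det_map_mx/=.
  by rewrite rmorph_int rmorph_nat -intr_norm -natr_absz.
exists rho; split=> //.
rewrite unitmxE unitfE; apply: contraTneq rho1 => detB.
move: detM; rewrite /M det_map_mx detB rmorph0 normr0 => /esym/eqP.
by rewrite expf_eq0/= -(rmorph0 (real_complex R)) (inj_eq (@complexI R)) => /eqP ->;
  rewrite ltr10.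
Qed.

End Spectrum.

Lemma lt_powR_exponent (R : realType) (a x y : R) : 1 < a -> x < y -> a `^ x < a `^ y.
Proof.
move=> a1 xy; rewrite /powR gt_eqF ?(lt_trans _ a1)// ltr_expR ltr_pM2r//.
by rewrite ln_gt0.
Qed.

Lemma powR_exprn (R : realType) (a e : R) n :
  0 <= a -> (a `^ e) ^+ n = (a ^+ n) `^ e.
Proof.
by move=> a0; rewrite -(powR_mulrn n (powR_ge0 a e)) -(powR_mulrn n a0) -!powRrM mulrC.
Qed.

Section Dilation.
Variables (R : realType) (d : nat) (B : 'M[R]_d.+1) (rho : R).
Hypotheses (Bunit : B \is a GRing.unit) (rho1 : 1 < rho).
Hypothesis Brho : forall z : R[i],
  eigenvalue (map_mx (real_complex R) B) z -> `|z| = rho%:C%C.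
Implicit Types x v : 'cV[R]_d.+1.

Lemma pow_le a : rho < a ->
  exists2 c : R, 0 < c & forall n x, `|B ^+ n *m x| <= c * a ^+ n * `|x|.
Proof. exact: pow_mulmx_le. Qed.

Lemma powV_le a : rho^-1 < a ->
  exists2 c : R, 0 < c & forall n x, `|B^-1 ^+ n *m x| <= c * a ^+ n * `|x|.
Proof.
apply: pow_mulmx_le => z; rewrite map_mx_inv => /eigenvalueV.
have -> : map_mx (real_complex R) B \is a GRing.unit.
  by move: Bunit; rewrite !unitmxE det_map_mx !unitfE fmorph_eq0.
move=> /(_ isT)/Brho; rewrite normfV => /(congr1 GRing.inv).
by rewrite invrK -fmorphV.
Qed.

Lemma powVK n x : B^-1 ^+ n *m (B ^+ n *m x) = x.
Proof.
by rewrite mulmxA -[_ *m B ^+ n]/(_ * _) exprVn mulVr ?unitrX// mul1mx.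
Qed.

Lemma powKV n x : B ^+ n *m (B^-1 ^+ n *m x) = x.
Proof.
by rewrite mulmxA -[_ *m B^-1 ^+ n]/(_ * _) exprVn mulrV ?unitrX// mul1mx.
Qed.

(** Any rate between 1 / rho and 1 bounds the iterates of the inverse, so these
contract bounded sets uniformly; this is how orbits of B are located. *)
Lemma powV_small r r' : 0 < r -> 0 < r' -> exists N, forall n x,
  (N <= n)%N -> `|x| <= r' -> `|B^-1 ^+ n *m x| < r.
Proof.
move=> r0 r'0; pose a := (rho^-1 + 1) / 2.
have rho0 : 0 < rho by exact: lt_trans rho1.
have rV1 : rho^-1 < 1 by rewrite invf_lt1.
have rV0 : 0 < rho^-1 by rewrite invr_gt0.
have ra : rho^-1 < a by rewrite (midf_lt rV1).
have [c c0 cB] := powV_le ra.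
have a0 : 0 < a by exact: lt_trans ra.
have a1 : a < 1 by rewrite (midf_lt rV1).
have : (fun n => c * r' * a ^+ n) @ \oo --> c * r' * 0.
  by apply: cvgMr; apply: cvg_expr; rewrite gtr0_norm.
rewrite mulr0 => /cvgrPdist_lt/(_ r r0)[N _ NP].
exists N => n x Nn xr'; have := NP n Nn; rewrite /= sub0r normrN.
apply: le_lt_trans; rewrite ger0_norm; last by rewrite !mulr_ge0 ?exprn_ge0 ?ltW.
apply: le_trans (cB n x) _.
by rewrite -[leRHS]mulrA (mulrC r') mulrA ler_wpM2l// mulr_ge0 ?exprn_ge0 ?(ltW a0)// ltW.
Qed.

(** At the first n where the orbit of x reaches norm r, the previous point has
norm below r, so the overshoot is at most the norm of B. *)
Lemma forward_passage r : 0 < r -> exists r' : R,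
  forall x, x != 0 -> `|x| < r -> exists n, r <= `|B ^+ n *m x| <= r'.
Proof.
move=> r0; have [c c0 cB] := mulmx_bounded B; exists (c * r) => x x0 xr.
have exn : exists n, r <= `|B ^+ n *m x|.
  apply: contrapT => /forallNP nr.
  have x0' : 0 < `|x| by rewrite normr_gt0.
  have [N NP] := powV_small x0' r0.
  have Nr : `|B ^+ N *m x| <= r by apply/ltW; rewrite ltNge; exact/negP/nr.
  by have := NP N _ (leqnn N) Nr; rewrite powVK ltxx.
have := ex_minnP exn; case=> -[|n]; first by rewrite expr0 mul1mx leNgt xr.
move=> rn minn; exists n.+1; rewrite rn /= exprS -mulmxA.
apply: le_trans (cB _) _; rewrite ler_pM2l// leNgt; apply/negP => /ltW/minn.
by rewrite ltnn.
Qed.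

(** The same first-passage argument for the inverse: the last step cannot shrink
the norm by more than the norm of B. *)
Lemma backward_passage : exists2 r : R, 0 < r &
  forall x, 1 <= `|x| -> exists n, r <= `|B^-1 ^+ n *m x| <= 1.
Proof.
have [c c0 cB] := mulmx_bounded B; exists c^-1; rewrite ?invr_gt0// => x x1.
have exn : exists n, `|B^-1 ^+ n *m x| < 1.
  have x0 : 0 < `|x| by apply: lt_le_trans x1.
  have [N NP] := powV_small (@ltr01 R) x0.
  by exists N; exact: NP.
have := ex_minnP exn; case=> -[|n]; first by rewrite expr0 mul1mx ltNge x1.
move=> rn minn; exists n.+1; rewrite (ltW rn) andbT -div1r ler_pdivrMr// mulrC.
apply: le_trans (cB _).
rewrite exprS -[B^-1 * _]/(B^-1 *m _) -mulmxA (mulmxA B).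
rewrite -[B *m B^-1]/(B * B^-1) mulrV// mul1mx leNgt; apply/negP => /minn.
by rewrite ltnn.
Qed.


(** * Comparing a homogeneous function with the norm *)

Section Comparison.
Variable w : 'cV[R]_d.+1 -> R.
Hypotheses (w0 : w 0 = 0) (wB : forall x, w (B *m x) = rho * w x).
Hypothesis w_annulus : forall r r' : R, 0 < r -> exists c c' : R,
  [/\ 0 < c, 0 < c' & forall v, r <= `|v| <= r' -> c <= w v <= c'].

Lemma w_pow n x : w (B ^+ n *m x) = rho ^+ n * w x.
Proof.
elim: n => [|n IHn]; first by rewrite !expr0 mul1mx mul1r.
by rewrite exprS -[B * _]/(B *m _) -mulmxA wB IHn mulrA exprS.
Qed.

Lemma w_ge0 x : 0 <= w x.
Proof.
have [->|x0] := eqVneq x 0; first by rewrite w0.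
rewrite -normr_gt0 in x0; have [c [c' [c0 _ wc]]] := w_annulus `|x| x0.
have /andP[cw _] : c <= w x <= c' by apply: wc; rewrite lexx.
exact: le_trans (ltW c0) cw.
Qed.

(** A point x outside the unit ball is B ^ n v with v in a fixed annulus, and
w x <= W bounds rho ^ n; growth at rate rho ^ 2 > rho then bounds |x| by a
multiple of (rho ^ n) ^ 2. *)
Lemma norm_le_of_w_le W : exists2 L : R, 0 < L & forall x, w x <= W -> `|x| <= L.
Proof.
have [r r0 rP] := backward_passage.
have [c [c' [c0 _ wc]]] := w_annulus 1 r0.
have rho0 : 0 < rho by exact: lt_trans rho1.
have rr : rho < rho ^+ 2 by rewrite expr2 ltr_pMr.
have [K K0 BK] := pow_le rr.
exists (1 + K * (W / c) ^+ 2) => [|x xW].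
  by rewrite ltr_pwDl// mulr_ge0 ?(ltW K0)// sqr_ge0.
have [x1|/ltW x1] := leP `|x| 1.
  by apply: le_trans x1 _; rewrite lerDl mulr_ge0 ?(ltW K0)// sqr_ge0.
have [n /andP[rn n1]] := rP x x1.
have rhon : rho ^+ n <= W / c.
  rewrite ler_pdivlMr//; apply: le_trans xW.
  rewrite -[in leRHS](powKV n x) w_pow ler_pM2l ?exprn_gt0//.
  by apply: (andP (wc _ _)).1; rewrite rn n1.
rewrite -[leLHS](congr1 (fun y => `|y|) (powKV n x)).
apply: le_trans (BK n _) _; rewrite -exprM mulnC exprM.
apply: (@le_trans _ _ (K * (rho ^+ n) ^+ 2 * 1)).
  by rewrite ler_wpM2l// mulr_ge0 ?(ltW K0)// sqr_ge0.
rewrite mulr1; apply: (@le_trans _ _ (K * (W / c) ^+ 2)); last by rewrite lerDr.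
rewrite ler_pM2l// lerXn2r// nnegrE ?exprn_ge0 ?(ltW rho0)//.
by rewrite (le_trans _ rhon)// exprn_ge0// ltW.
Qed.

(** With x = B ^ (- n) v and v in a fixed annulus, rho ^ n * w x is bounded above
and below.  The rates rho ^ (1 + s) > rho for B and rho ^ (- (1 - s)) > 1 / rho
for its inverse turn this into the two inequalities. *)
Lemma w_norm_hoelder s L : 0 < s < 1 -> exists2 C : R, 0 < C &
  forall x, `|x| <= L -> w x `^ (1 + s) <= C * `|x| /\ `|x| <= C * w x `^ (1 - s).
Proof.
move=> /andP[s0 s1]; have p0 : 0 < 1 + s by rewrite addr_gt0.
have m0 : 0 < 1 - s by rewrite subr_gt0.
have rho0 : 0 < rho by exact: lt_trans rho1.
pose r := `|L| + 1; have r0 : 0 < r by rewrite ltr_wpDl.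
have [r' rP] := forward_passage r0.
have [c [c' [c0 c'0 wc]]] := w_annulus r' r0.
have [K K0 BK] : exists2 K : R, 0 < K & forall n x,
    `|B ^+ n *m x| <= K * (rho `^ (1 + s)) ^+ n * `|x|.
  by apply: pow_le; rewrite -[ltLHS]powRr1 ?(ltW rho0)// lt_powR_exponent// ltrDl.
have [K' K'0 BK'] : exists2 K : R, 0 < K & forall n x,
    `|B^-1 ^+ n *m x| <= K * (rho `^ (- (1 - s))) ^+ n * `|x|.
  apply: powV_le; rewrite -powR_inv1 ?(ltW rho0)// lt_powR_exponent//.
  by rewrite ltrN2 gtrBl.
pose C1 := K / r * c' `^ (1 + s); pose C2 := K' * `|r'| / c `^ (1 - s).
have C10 : 0 < C1 by rewrite !mulr_gt0 ?invr_gt0 ?powR_gt0.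
have C20 : 0 <= C2 by rewrite !mulr_ge0 ?invr_ge0 ?powR_ge0 ?(ltW K'0).
exists (C1 + C2) => [|x xL]; first exact: ltr_pwDl.
have [->|x0] := eqVneq x 0.
  by rewrite w0 normr0 !powR0 ?gt_eqF// !mulr0.
have [|n rn] := rP _ x0; first by rewrite (le_lt_trans xL)// /r ltr_pwDr// ler_norm.
have /andP[cw wc'] := wc _ rn; move: cw wc'; rewrite w_pow => cw wc'.
move/andP: rn => [rn nr'].
have t0 : 0 < rho ^+ n by rewrite exprn_gt0.
have powRn e : (rho `^ e) ^+ n = (rho ^+ n) `^ e.
  by rewrite powR_exprn// ltW.
have wx0 := w_ge0 x; split.
  apply: (@le_trans _ _ (C1 * `|x|)); last by rewrite ler_wpM2r// lerDl.
  have -> : C1 * `|x| = K * c' `^ (1 + s) * `|x| / r by rewrite /C1; ring.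
  rewrite ler_pdivlMr//.
  have wt : w x `^ (1 + s) * (rho ^+ n) `^ (1 + s) <= c' `^ (1 + s).
    rewrite -powRM// ?(ltW t0)// mulrC ge0_ler_powR ?nnegrE ?(ltW p0) ?(ltW c'0)//.
    by rewrite mulr_ge0// ltW.
  have := le_trans rn (BK n x); rewrite powRn => rK.
  apply: le_trans (ler_wpM2l (powR_ge0 _ _) rK) _.
  rewrite [leLHS](_ : _ = K * (w x `^ (1 + s) * (rho ^+ n) `^ (1 + s)) * `|x|).
    by rewrite ler_wpM2r// ler_wpM2l// ltW.
  ring.
apply: (@le_trans _ _ (C2 * w x `^ (1 - s))); last by rewrite ler_wpM2r ?powR_ge0// lerDr ltW.
rewrite /C2 mulrAC ler_pdivlMr ?powR_gt0//.
have tw : c `^ (1 - s) <= (rho ^+ n) `^ (1 - s) * w x `^ (1 - s).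
  rewrite -powRM// ?(ltW t0)// ge0_ler_powR ?nnegrE ?(ltW m0) ?(ltW c0)//.
  by rewrite mulr_ge0// ltW.
apply: le_trans (ler_wpM2l (normr_ge0 _) tw) _.
rewrite mulrA ler_wpM2r ?powR_ge0//.
have := BK' n (B ^+ n *m x); rewrite powVK powRn powRN => xK.
rewrite -ler_pdivlMr ?powR_gt0//; apply: le_trans xK _.
rewrite [leLHS]mulrAC ler_wpM2r ?invr_ge0 ?powR_ge0// ler_wpM2l ?(ltW K'0)//.
exact: le_trans nr' (ler_norm _).
Qed.

(** The two inequalities of [w_norm_hoelder] compose to the exponent
(1 - s) / (1 + s), which is eta for s = (1 - eta) / (1 + eta). *)
Lemma nearly_equivalent_of_w (E F : set 'cV[R]_d.+1) :
  bounded_set E -> w_equivalent w E F -> nearly_equivalent E F.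
Proof.
move=> [M [_ EM]] [sigma [C [bij C0 sigmaC]]] eta /andP[eta0 eta1].
have {}EM x : E x -> `|x| <= M + 1 by move=> Ex; apply: EM => //; rewrite ltrDl.
pose L := (M + 1) + (M + 1).
have EL x y : E x -> E y -> `|x - y| <= L.
  by move=> Ex Ey; apply: le_trans (ler_normB _ _) _; rewrite lerD// EM.
pose s := (1 - eta) / (1 + eta).
have eta1_gt0 : 0 < 1 + eta by rewrite addr_gt0.
have s01 : 0 < s < 1.
  by rewrite /s divr_gt0 ?subr_gt0//= ltr_pdivrMr// mul1r; lra.
have p0 : 0 < 1 + s by move/andP: s01 => [s0 _]; rewrite addr_gt0.
have m0 : 0 < 1 - s by move/andP: s01 => [_ s1]; rewrite subr_gt0.
have mp : 1 - s = (1 + s) * eta by rewrite /s; field; rewrite gt_eqF.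
have etaV0 : 0 < eta^-1 by rewrite invr_gt0.
have pm : 1 + s = (1 - s) * eta^-1 by rewrite mp mulfK// gt_eqF.
have [K0' K0'0 KL] := w_norm_hoelder L s01.
have wL x : `|x| <= L -> w x <= 1 + K0' * L.
  move=> xL; have [w1|/ltW w1] := leP (w x) 1.
    apply: le_trans w1 _; rewrite lerDl mulr_ge0 ?(ltW K0'0)//.
    exact: le_trans xL.
  apply: (@le_trans _ _ (w x `^ (1 + s))).
    by rewrite le1r_powR// lerDl; case/andP: s01 => /ltW.
  apply: le_trans (KL x xL).1 _; rewrite ler_wpDl// ler_wpM2l// ltW//.
(* w is bounded on E - E, hence on F - F, hence the norm is bounded on F - F. *)
have [L' L'0 wL'] := norm_le_of_w_le (C * (1 + K0' * L)).
have [K K0 KP] := w_norm_hoelder (Num.max L L') s01.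
pose D : R := d.+1%:R; have D0 : 0 < D by rewrite ltr0n.
pose C1 := D * (K * C `^ (1 - s) * K `^ eta).
pose C2 := D `^ eta^-1 * (K `^ eta^-1 * C `^ (1 + s) * K).
have C10 : 0 < C1 by rewrite !mulr_gt0 ?powR_gt0.
have C20 : 0 < C2 by rewrite !mulr_gt0 ?powR_gt0.
exists sigma, (C1 + C2); split=> //; first exact: addr_gt0.
move=> x y Ex Ey; have /andP[wl wu] := sigmaC x y Ex Ey.
set X := x - y in wl wu *; set Y := sigma x - sigma y in wl wu *.
have XL : `|X| <= L by exact: EL.
have YL' : `|Y| <= L'.
  by apply/wL'/(le_trans wu); rewrite ler_pM2l// wL.
have [Xp Xm] := KP X ltac:(by rewrite le_max XL).
have [Yp Ym] := KP Y ltac:(by rewrite le_max YL' orbT).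
have wX := w_ge0 X; have wY := w_ge0 Y.
rewrite ler_pdivrMl// in wl.
have mono e a b : 0 < e -> 0 <= a -> a <= b -> a `^ e <= b `^ e :> R.
  move=> e0 a0 ab; rewrite ge0_ler_powR ?nnegrE ?(ltW e0)//.
  exact: le_trans ab.
have nX := norm_le_enorm X; have nY := norm_le_enorm Y.
have eX := enorm_le_norm X; have eY := enorm_le_norm Y.
have eX0 : 0 <= enorm X by exact: sqrtr_ge0.
apply/andP; split; last first.
  apply: (@le_trans _ _ (C1 * enorm X `^ eta)); last first.
    by rewrite ler_wpM2r ?powR_ge0// lerDl ltW.
  apply: le_trans eY _; rewrite /C1 -!mulrA ler_pM2l//.
  apply: le_trans Ym _; rewrite ler_pM2l//.
  apply: le_trans (mono _ _ _ m0 wY wu) _.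
  rewrite powRM ?(ltW C0)// ler_wpM2l ?powR_ge0//.
  rewrite mp powRrM -powRM ?(ltW K0)//.
  apply: mono => //; first exact: powR_ge0.
  by apply: le_trans Xp _; rewrite ler_pM2l.
rewrite ler_pdivrMl ?addr_gt0//.
apply: (@le_trans _ _ (C2 * enorm Y)); last first.
  by rewrite ler_wpM2r ?sqrtr_ge0// lerDr ltW.
apply: le_trans (mono _ _ _ etaV0 eX0 eX) _.
rewrite powRM ?(ltW D0)// /C2 -!mulrA ler_pM2l ?powR_gt0//.
apply: le_trans (mono _ _ _ etaV0 (normr_ge0 X) Xm) _.
rewrite powRM ?powR_ge0 ?(ltW K0)// -powRrM -pm ler_pM2l ?powR_gt0//.
apply: le_trans (mono _ _ _ p0 wX wl) _.
rewrite powRM ?(ltW C0)// ler_pM2l ?powR_gt0//.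
by apply: le_trans Yp _; rewrite ler_pM2l.
Qed.

End Comparison.
End Dilation.

(** * Compactness in the space of column vectors *)

Section Topology.
Variables (R : realType) (d : nat).

Lemma near_dist_lt (V : normedModType R) (x : V) (e : R) :
  0 < e -> \forall y \near x, `|x - y| < e.
Proof. by move=> e0; apply/nbhs_normP; exists e. Qed.

Lemma mulmx_continuous (B : 'M[R]_d.+1) : continuous (fun x : 'cV[R]_d.+1 => B *m x).
Proof.
have [c c0 cB] := mulmx_bounded B.
suff H (x : 'cV[R]_d.+1) : (fun y => B *m y) @ x --> B *m x by exact: H.
apply/(@cvgrPdist_lt R 'cV[R]_d.+1 _ (nbhs x) _ (mulmx B)) => e e0; near=> y.
rewrite -mulmxBr; apply: le_lt_trans (cB _) _; rewrite -ltr_pdivlMl//.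
by near: y; apply: (@near_dist_lt 'cV[R]_d.+1); rewrite mulr_gt0// invr_gt0.
Unshelve. all: by end_near. Qed.

(** Transposition carries the statement over from row vectors. *)
Lemma bounded_closed_compact_cV (K : set 'cV[R]_d.+1) :
  bounded_set K -> closed K -> compact K.
Proof.
move=> [M [Mreal KM]] Kcl.
have trC : continuous (fun u : 'rV[R]_d.+1 => u^T : 'cV[R]_d.+1).
  suff H (u : 'rV[R]_d.+1) : (fun v : 'rV[R]_d.+1 => v^T) @ u --> u^T by exact: H.
  apply/(@cvgrPdist_lt R 'cV[R]_d.+1 _ (nbhs u) _ (fun v => v^T)) => e e0; near=> v.
  apply: (@le_lt_trans _ _ `|u - v|).
    apply: norm_le_entries => // i; rewrite !mxE [leRHS]/Num.Def.normr/= mx_normrE.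
    by have := @le_bigmax _ _ _ 0 (fun ij : 'I_1 * 'I_d.+1 => `|(u - v) ij.1 ij.2|) (0, i);
      rewrite /= !mxE.
  by near: v; exact: (@near_dist_lt 'rV[R]_d.+1).
have -> : K = (fun u : 'rV[R]_d.+1 => u^T) @` [set u | K u^T].
  apply/seteqP; split=> [x Kx|_ [u Ku <-]//].
  by exists x^T; rewrite /= trmxK.
apply: continuous_compact; first exact/continuous_subspaceT.
apply: bounded_closed_compact; last exact: (closed_comp _ Kcl).
exists M; split=> // N MN u /(KM N MN) uN; apply: le_trans uN.
rewrite [leLHS]/Num.Def.normr/= mx_normrE; apply/bigmax_leP; split=> // -[i j] _ /=.
by rewrite ord1; have := entry_le_norm u^T j; rewrite mxE.
Unshelve. all: by end_near. Qed.

Lemma closed_annulus_compact (r r' : R) :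
  compact [set v : 'cV[R]_d.+1 | r <= `|v| <= r'].
Proof.
apply: bounded_closed_compact_cV.
  exists r'; split=> [|M r'M v /= /andP[_ /le_trans]]; first exact: num_real.
  by apply; exact: ltW.
have -> : [set v : 'cV[R]_d.+1 | r <= `|v| <= r'] =
    (fun v => `|v|) @^-1` ([set x | x >= r] `&` [set x | x <= r']).
  by apply/seteqP; split=> v /= => [/andP//|[-> ->]].
apply: closed_comp; first by move=> v _; exact: norm_continuous.
by apply: closedI; [exact: closed_ge|exact: closed_le].
Qed.

(** This is the near-covering form of compactness, for the filter of constants c
decreasing to 0: near each point, every small enough c is a lower bound. *)
Lemma locally_bounded_below_compact (K : set 'cV[R]_d.+1) (f : 'cV[R]_d.+1 -> R) :
  compact K ->
  (forall v, K v -> exists2 c, 0 < c & \forall x \near v, c <= f x) ->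
  exists2 c, 0 < c & forall v, K v -> c <= f v.
Proof.
move=> /compact_near_coveringP cK Kf.
have Kc : \forall c \near 0^'+, K `<=` (fun v => c <= f v).
  apply: (cK R (0^'+) (fun c v => c <= f v)) => v Kv.
  have [c c0 cf] := Kf v Kv; near=> x e => /=.
  apply: (@le_trans _ _ c); first by near: e; exact: nbhs_right_le.
  by near: x.
have : \forall c \near 0^'+, 0 < c /\ K `<=` (fun v => c <= f v).
  by near=> c; split; near: c => //; exact: nbhs_right_gt.
by move=> /filter_ex[c [c0 cf]]; exists c.
Unshelve. all: by end_near. Qed.

End Topology.

(** * The bump function *)

Section Bump.
Variables (R : realType) (d : nat) (A : 'M[int]_d.+1) (phi : 'cV[R]_d.+1 -> R).
Variable delta : R.
Hypotheses (phiC : continuous phi) (phi_ge0 : forall x, 0 <= phi x).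
Hypotheses (delta_small : 0 < delta < 2^-1).
Hypothesis phi_supp : forall x, phi x != 0 -> enorm x < delta.
Implicit Types x y v : 'cV[R]_d.+1.

(** Uniform continuity on a compact set, in the form used for the integrands of
a convolution. *)
Lemma translate_near (K : set 'cV[R]_d.+1) x0 e : compact K -> 0 < e ->
  \forall x \near x0, forall y, K y -> `|phi (x0 - y) - phi (x - y)| < e.
Proof.
move=> /compact_near_coveringP cK e0.
apply: (cK 'cV[R]_d.+1 (nbhs x0) (fun x y => `|phi (x0 - y) - phi (x - y)| < e)).
move=> y0 Ky0.
have e20 : 0 < e / 2 by rewrite divr_gt0.
have : \forall z \near x0 - y0, `|phi (x0 - y0) - phi z| < e / 2.
  have phi0 : phi @ (x0 - y0) --> phi (x0 - y0) by exact: phiC.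
  exact: (@cvgrPdist_lt R R^o _ (nbhs (x0 - y0)) _ phi _).1 phi0 _ e20.
move=> /nbhs_normP[r /= r0 phir].
have r20 : 0 < r / 2 by rewrite divr_gt0.
near=> y x => /=.
have yr : `|y0 - y| < r / 2 by near: y; exact: (@near_dist_lt R 'cV[R]_d.+1).
have xr : `|x0 - x| < r / 2 by near: x; exact: (@near_dist_lt R 'cV[R]_d.+1).
have h1 : `|phi (x0 - y0) - phi (x0 - y)| < e / 2.
  apply: phir => /=.
  have -> : x0 - y0 - (x0 - y) = - (y0 - y) by apply/matrixP => i j; rewrite !mxE; ring.
  rewrite normrN.
  by apply: lt_trans yr _; rewrite ltr_pdivrMr// ltr_pMr// ltr1n.
have h2 : `|phi (x0 - y0) - phi (x - y)| < e / 2.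
  apply: phir => /=.
  have -> : x0 - y0 - (x - y) = (x0 - x) - (y0 - y).
    by apply/matrixP => i j; rewrite !mxE; ring.
  by apply: le_lt_trans (ler_normB _ _) _; rewrite [r]splitr ltrD.
rewrite (_ : phi (x0 - y) - _ =
    (phi (x0 - y0) - phi (x - y)) - (phi (x0 - y0) - phi (x0 - y))).
  by apply: le_lt_trans (ler_normB _ _) _; rewrite [e]splitr ltrD.
by ring.
Unshelve. all: by end_near. Qed.

Lemma phi_bounded : exists2 Phi : R, 0 <= Phi & forall x, phi x <= Phi.
Proof.
have := continuous_compact (continuous_subspaceT phiC) (@closed_annulus_compact R d 0 1).
move=> /compact_bounded[M [_ MP]]; exists (`|M| + 1); first by rewrite addr_ge0.
move=> x; have [->|px] := eqVneq (phi x) 0; first by rewrite addr_ge0.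
apply: le_trans (ler_norm _) _; apply: MP; first by rewrite ltr_pwDr// ler_norm.
exists x => //=; rewrite normr_ge0 /=; apply: le_trans (norm_le_enorm x) _.
apply/ltW/(lt_trans (phi_supp px)); case/andP: delta_small => _ /lt_trans; apply.
by rewrite invf_lt1// ltr1n.
Qed.

Lemma annulus_bounded : exists2 r : R, 0 < r & forall y, annulus A y -> `|y| <= r.
Proof.
have [c c0 cB] := mulmx_bounded (real_mx R A); exists c => // y [[x /= x1 <-] _].
apply: le_trans (cB x) _; rewrite ger_pMr//.
exact: le_trans (norm_le_enorm x) (ltW x1).
Qed.

Lemma bump_integrand_ge0 x y : (0 <= (\1_(annulus A) y * phi (x - y))%:E)%E.
Proof. by rewrite lee_fin mulr_ge0. Qed.

Lemma bump_ge0 x : (0 <= Defs.bump A phi x)%E.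
Proof. by apply: integral_ge0 => t _; exact: bump_integrand_ge0. Qed.

(** The integral as a supremum over simple functions: the bump can then be bounded
from both sides by comparing simple functions pointwise, whatever the
measurability of the integrand. *)
Lemma bumpE x : Defs.bump A phi x =
  ereal_sup [set sintegral (@lebesgue_tuple R d.+1) h | h in
    [set h : {nnsfun (d.+1.-tuple R) >-> R} | forall t,
      ((h t)%:E <= (\1_(annulus A) (\col_i tnth t i)%R * phi (x - \col_i tnth t i))%:E)%E]].
Proof. by rewrite [LHS]ge0_integralTE// => t; exact: bump_integrand_ge0. Qed.

(** A nonzero value at x requires some y with 1 <= enorm y and
enorm (x - y) < 1/2; then y^2 <= 2 x^2 + 2 (x - y)^2, summed over the
coordinates, keeps x away from 0. *)
Lemma bump_eq0 : exists r r' : R, [/\ 0 < r, 0 < r' &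
  forall x, Defs.bump A phi x != 0%E -> r <= `|x| <= r'].
Proof.
have [c c0 Vc] := annulus_bounded.
exists (2 * d.+1%:R)^-1, (c + 1); split=> [||x].
- by rewrite invr_gt0 mulr_gt0.
- exact: addr_gt0.
apply: contraNT => xr; rewrite /Defs.bump /convolution /integral_cV.
apply/eqP/integral0_eq => t _; set y := \col_i _; apply/eqP; apply: contraNT xr.
rewrite eqe mulf_eq0 negb_or => /andP[Vy /phi_supp xy].
have {}Vy : annulus A y.
  by apply: contrapT => nVy; move: Vy; rewrite indicE memNset ?eqxx.
have xy2 : enorm (x - y) < 2^-1.
  by case/andP: delta_small => _; exact: lt_trans.
apply/andP; split; last first.
  rewrite -[x](subrK y) addrC; apply: le_trans (ler_normD _ _) _.
  apply: lerD; first exact: Vc.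
  apply: le_trans (norm_le_enorm _) _; apply/ltW/(lt_trans xy2).
  by rewrite invf_lt1// ltr1n.
have y1 : 1 <= enorm y by case: Vy => _ /=/negP; rewrite -leNgt.
have x2 : 2^-1 <= enorm x.
  rewrite -(@ler_pXn2r _ 2)// ?nnegrE ?sqrtr_ge0//.
  have := sqrtr_ge0; move: y1 xy2.
  rewrite -(@ler_pXn2r _ 2)// ?nnegrE ?sqrtr_ge0// -(@ltr_pXn2r _ 2)// ?nnegrE ?sqrtr_ge0//.
  rewrite !sqr_sqrtr ?enorm_sqr_ge0// => y1 xy2 _.
  have : \sum_i y i 0 ^+ 2 <= 2 * (\sum_i x i 0 ^+ 2) + 2 * \sum_i (x - y) i 0 ^+ 2.
    rewrite !mulr_sumr -big_split /=; apply: ler_sum => i _.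
    have -> : (x - y) i 0 = x i 0 - y i 0 by rewrite !mxE.
    rewrite -subr_ge0 [leRHS](_ : _ = (2 * x i 0 - y i 0) ^+ 2) ?sqr_ge0//; ring.
  by lra.
rewrite -(@ler_pM2l _ d.+1%:R)// invfM mulrCA divff// mulr1.
exact: le_trans x2 (enorm_le_norm x).
Qed.

Lemma box_measurable n (I : set R) : measurable I ->
  measurable [set t : n.-tuple R | forall i, I (tnth t i)].
Proof.
move=> mI; rewrite [X in measurable X](_ : _ =
  \bigcap_(i in [set: 'I_n]) ((@tnth n R ^~ i) @^-1` I)); last first.
  by apply/seteqP; split=> t /= It i; [move=> _|]; exact: It.
apply: fin_bigcap_measurable => [|i _]; first exact: finite_finset.
by rewrite -[X in measurable X]setTI; exact: measurable_tnth.
Qed.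

(** The integrand is dominated by a multiple of the indicator of a cube. *)
Lemma bump_bounded : exists2 H : R, 0 <= H & forall x, (Defs.bump A phi x <= H%:E)%E.
Proof.
have [c c0 Vc] := annulus_bounded; have [Phi Phi0 phiPhi] := phi_bounded.
pose box := [set t : d.+1.-tuple R | forall i, `[(- c), c]%classic (tnth t i)].
have mbox : measurable box by exact: box_measurable.
pose g := scale_nnsfun (indic_nnsfun R mbox) Phi0.
exists (Phi * \prod_(i < d.+1) (c + c)) => [|x].
  by rewrite mulr_ge0// prodr_ge0// => i _; rewrite addr_ge0// ltW.
have gE : sintegral (@lebesgue_tuple R d.+1) g = (Phi * \prod_(i < d.+1) (c + c))%:E.
  rewrite (sintegralrM (@lebesgue_tuple R d.+1) Phi (indic_nnsfun R mbox)).
  rewrite sintegral_indic EFinM; congr (_ * _)%E.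
  rewrite (@lebesgue_tuple_box R d.+1 (fun=> `[(- c), c]%classic))// -prodEFin.
  apply: eq_bigr => i _; rewrite lebesgue_measure_itv/= lte_fin gtrN//.
  by rewrite -EFinB opprK.
rewrite bumpE -gE; apply: ge_ereal_sup => _ [h /= hf <-].
have hg t : h t <= g t.
  have := hf t; rewrite lee_fin => /le_trans; apply.
  rewrite -[g t]/(Phi * \1_box t) mulrC.
  apply: ler_pM => //.
  rewrite !indicE; case: (boolP (_ \in annulus A)) => [|_ //]; rewrite inE => Vt.
  suff boxt : box t by rewrite mem_set.
  move=> i; rewrite /= in_itv/= -ler_norml.
  by have := entry_le_norm (\col_i tnth t i) i; rewrite mxE => /le_trans; apply; exact: Vc.
exact: (@le_sintegral _ _ R (@lebesgue_tuple R d.+1) h g hg).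
Qed.

(** A simple function has finitely many values. *)
Lemma simple_positive_min dd (T : measurableType dd) (h : {nnsfun T >-> R}) :
  exists2 a : R, 0 < a & forall t, h t != 0 -> a <= h t.
Proof.
have [s hs] := (finite_seqP _).1 (fimfunP h).
have : exists2 a : R, 0 < a & forall b, b \in s -> 0 < b -> a <= b.
  elim: s {hs} => [|b s [a a0 IHs]]; first by exists 1.
  have [b0|b0] := leP b 0.
    exists a => // z; rewrite in_cons => /predU1P[->|/IHs//].
    by rewrite ltNge b0.
  exists (Num.min a b) => [|z]; first by rewrite lt_min a0.
  rewrite in_cons ge_min => /predU1P[->|/IHs zs /zs -> //].
  by rewrite lexx orbT.
move=> [a a0 sa]; exists a => // t ht; apply: sa; last by rewrite lt_neqAle eq_sym ht fun_ge0.
have : range h (h t) by exists t.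
by rewrite hs.
Qed.

(** Take a simple function h below the integrand at x0 with positive integral,
and let a be its least positive value.  Uniform continuity makes the integrands
at x near x0 differ by less than a / 2 from the one at x0, on the annulus; so
h / 2 <= h - a / 2 stays below them wherever h does not vanish. *)
Lemma bump_gt0_near x0 : (0 < Defs.bump A phi x0)%E ->
  exists2 c : R, 0 < c & \forall x \near x0, (c%:E <= Defs.bump A phi x)%E.
Proof.
rewrite {1}bumpE => /ereal_sup_gt[_ [h /= hf <-] h0].
have [r r0 Vr] := annulus_bounded.
have [a a0 ha] := simple_positive_min h.
have half0 : 0 <= 2^-1 :> R by rewrite invr_ge0.
have [c c0 ch] : exists2 c : R, 0 < c &
    (c%:E <= sintegral (@lebesgue_tuple R d.+1) (scale_nnsfun h half0))%E.
  rewrite (sintegralrM _ _ h).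
  (* The integral of h may be infinite; any c then works. *)
  case: (sintegral _ h) h0 => [b|_|//]; last first.
    by exists 1 => //; rewrite gt0_muley ?leey// lte_fin invr_gt0.
  by rewrite lte_fin => b0; exists (2^-1 * b) => //; rewrite mulr_gt0.
exists c => //.
have a20 : 0 < a / 2 by rewrite divr_gt0.
have := translate_near x0 (@closed_annulus_compact R d 0 r) a20.
apply: filterS => x xnear; apply: le_trans ch _; rewrite bumpE.
apply: ereal_sup_ubound; exists (scale_nnsfun h half0) => // t.
rewrite -[scale_nnsfun h half0 t]/(2^-1 * h t) lee_fin.
have := hf t; rewrite lee_fin; set y := \col_i tnth t i.
have [->|ht] := eqVneq (h t) 0; first by move=> _; rewrite mulr0 mulr_ge0.
rewrite indicE; case: (boolP (y \in annulus A)); last first.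
  by rewrite mul0r => _ ht0; move: ht; rewrite eq_le ht0 fun_ge0.
rewrite inE !mul1r => Vy hy.
have := xnear y; rewrite /= normr_ge0 Vr// => /(_ isT); rewrite ltr_norml => /andP[_].
by have := ha t ht; lra.
Qed.

End Bump.

(** * Homogeneity of the pseudo-norm and its bounds on annuli *)

Section Series.
Variables (R : realType) (d : nat) (A : 'M[int]_d.+1) (rho : R).
Local Notation B := (real_mx R A).
Hypotheses (rho1 : 1 < rho) (rhoq : rho ^+ d.+1 = (`|\det A|%N)%:R).
Hypothesis Bunit : B \is a GRing.unit.
Hypothesis Brho : forall z : R[i],
  eigenvalue (map_mx (real_complex R) B) z -> `|z| = rho%:C%C.
Variables (phi : 'cV[R]_d.+1 -> R) (delta : R).
Hypotheses (phiC : continuous phi) (phi_ge0 : forall x, 0 <= phi x).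
Hypotheses (delta_small : 0 < delta < 2^-1).
Hypothesis phi_supp : forall x, phi x != 0 -> enorm x < delta.
Implicit Types x y v : 'cV[R]_d.+1.

Let rho0 : 0 < rho. Proof. exact: lt_trans rho1. Qed.

(** The coefficient q ^ (- n / (d+1)) of the series is rho ^ (- n), an integer
power. *)
Definition series_term x (n : int) : \bar R :=
  ((rho ^ (- n))%:E * Defs.bump A phi (B ^ n *m x))%E.

Lemma pseudo_norm_seriesE x :
  pseudo_norm_series A phi x = (\esum_(n in [set: int]) series_term x n)%E.
Proof.
rewrite /pseudo_norm_series; apply: eq_esum => n _; congr (_%:E * _)%E.
rewrite -rhoq -powR_mulrn ?(ltW rho0)// -powRrM mulrN mulrCA divff// mulr1.
by rewrite -powR_intmul ?(ltW rho0)// mulrNz.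
Qed.

Lemma series_term_ge0 x n : (0 <= series_term x n)%E.
Proof. by rewrite mule_ge0 ?lee_fin ?exprz_ge0 ?(ltW rho0)// bump_ge0. Qed.

(** One inequality holds for every positive factor; the other is the same one for
the inverse factor. *)
Lemma esumZl (T : choiceType) (r : R) (a : T -> \bar R) : 0 < r ->
  (forall i, 0 <= a i)%E ->
  (\esum_(i in [set: T]) (r%:E * a i) = r%:E * \esum_(i in [set: T]) a i)%E.
Proof.
have le s (f : T -> \bar R) : 0 < s -> (forall i, 0 <= f i)%E ->
    (\esum_(i in [set: T]) (s%:E * f i) <= s%:E * \esum_(i in [set: T]) f i)%E.
  move=> s0 f0; apply: ge_ereal_sup => _ [X [finX _] <-].
  rewrite -ge0_mule_fsumr// lee_pmul2l//; apply: ereal_sup_ubound.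
  by exists X.
move=> r0 a0; apply/eqP; rewrite eq_le le//=.
have ra0 i : (0 <= r%:E * a i)%E by rewrite mule_ge0// lee_fin ltW.
have := le r^-1 (fun i => r%:E * a i)%E; rewrite invr_gt0 => /(_ r0 ra0).
rewrite (eq_esum (b := a)) => [|i _]; last first.
  by rewrite muleA -EFinM mulVf ?gt_eqF// mul1e.
by rewrite lee_pdivlMl.
Qed.

Lemma pseudo_norm_series_mulmx x :
  pseudo_norm_series A phi (B *m x) = (rho%:E * pseudo_norm_series A phi x)%E.
Proof.
rewrite !pseudo_norm_seriesE -esumZl//; last exact: series_term_ge0.
rewrite [RHS](reindex_esum [set: int] _ (fun n => n + 1)); last first.
  split=> // [m n _ _ /addIr//|n _]; exists (n - 1) => //=; exact: subrK.
apply: eq_esum => n _; rewrite /series_term mulmxA muleA -EFinM; congr (_%:E * _)%E.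
  by rewrite opprD expfzDr ?gt_eqF// mulrCA exprN1 divff ?gt_eqF// mulr1.
by congr (Defs.bump A phi (_ *m x)); rewrite exprzDr// expr1z.
Qed.

Lemma series_ge_term x n : (series_term x n <= pseudo_norm_series A phi x)%E.
Proof.
rewrite pseudo_norm_seriesE -(esum_set1 (series_term_ge0 x n)).
rewrite esum_mkcond; apply: le_esum => i _.
by case: ifPn => // _; exact: series_term_ge0.
Qed.

(** For n >= N the points B ^ n v lie beyond the support of the bump, and for
n <= - N' they lie in the hole around 0; the finitely many other terms are
bounded. *)
Lemma pseudo_norm_series_bounded r r' : 0 < r -> exists c : R, forall v,
  r <= `|v| <= r' -> (pseudo_norm_series A phi v <= c%:E)%E.
Proof.
move=> r0.
have [s [s' [s0 s'0 bump0]]] := bump_eq0 A delta_small phi_supp.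
have [H H0 bumpH] := bump_bounded A phiC phi_ge0 delta_small phi_supp.
have [N NP] := powV_small Bunit rho1 Brho r0 s'0.
have r'0 : 0 < `|r'| + 1 by rewrite ltr_wpDl.
have [N' N'P] := powV_small Bunit rho1 Brho s0 r'0.
pose X := (Posz @` `I_N) `|` ((fun k : nat => - k%:Z) @` `I_N').
have finX : finite_set X by rewrite finite_setU; split; exact: finite_image.
exists (\sum_(n \in X) (rho ^ (- n) * H)) => v /andP[rv vr'].
have zero n : n \notin X -> series_term v n = 0%E.
  move=> nX; rewrite /series_term.
  have [->|/bump0/andP[sv vs']] := eqVneq (Defs.bump A phi (B ^ n *m v)) 0%E.
    by rewrite mule0.
  exfalso; move: nX; rewrite notin_setE; apply.
  case: n sv vs' => n sv vs'.
    left; exists n => //=; rewrite ltnNge; apply/negP => Nn.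
    have := NP n (B ^+ n *m v) Nn vs'.
    by rewrite (powVK Bunit) ltNge rv.
  right; exists n.+1 => //=; rewrite ltnNge; apply/negP => Nn.
  have vr : `|v| <= `|r'| + 1.
    by apply: le_trans vr' _; rewrite ler_wpDr// ler_norm.
  have := N'P n.+1 v Nn vr.
  by rewrite exprVn ltNge; move: sv; rewrite NegzE -exprnN => ->.
rewrite pseudo_norm_seriesE -fsumEFin//.
rewrite (_ : esum _ _ = (\esum_(n in X) series_term v n)%E); last first.
  rewrite [RHS]esum_mkcond; apply: eq_esum => n _.
  by case: ifPn => // /zero.
rewrite esum_fset// => [|n _]; last exact: series_term_ge0.
apply: lee_fsum => // n _; rewrite /series_term EFinM.
by rewrite lee_wpmul2l ?bumpH// lee_fin exprz_ge0// ltW.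
Qed.

(** A positive sum has a positive term, and one term alone gives the bound. *)
Lemma pseudo_norm_series_gt0_near v : (0 < pseudo_norm_series A phi v)%E ->
  exists2 c : R, 0 < c & \forall x \near v, (c%:E <= pseudo_norm_series A phi x)%E.
Proof.
move=> wv.
have [n hn] : exists n, (0 < Defs.bump A phi (B ^ n *m v))%E.
  apply: contrapT => /forallNP h0; move: wv; rewrite pseudo_norm_seriesE esum1 ?ltxx//.
  move=> n _; rewrite /series_term.
  suff -> : Defs.bump A phi (B ^ n *m v) = 0%E by rewrite mule0.
  by apply/eqP; rewrite eq_le bump_ge0// andbT leNgt; apply/negP/h0.
have [c c0 cn] := bump_gt0_near phiC phi_ge0 hn.
have rn0 : 0 < rho ^ (- n) by rewrite exprz_gt0.
exists (rho ^ (- n) * c); first exact: mulr_gt0.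
have Bn : (fun x => B ^ n *m x) @ v --> B ^ n *m v by exact: mulmx_continuous.
have : \forall x \near v, (c%:E <= Defs.bump A phi (B ^ n *m x))%E by exact: Bn cn.
apply: filterS => x cx.
by apply: le_trans (series_ge_term x n); rewrite EFinM lee_pmul2l.
Qed.

End Series.

Lemma pseudo_norm_annulus (R : realType) d (A : 'M[int]_d.+1) (rho : R)
    (w : 'cV[R]_d.+1 -> R) :
  1 < rho -> rho ^+ d.+1 = (`|\det A|%N)%:R -> real_mx R A \is a GRing.unit ->
  (forall z, eigenvalue (map_mx (real_complex R) (real_mx R A)) z ->
    `|z| = rho%:C%C) ->
  pseudo_norm A w ->
  [/\ w 0 = 0, forall x, w (real_mx R A *m x) = rho * w x &
    forall r r' : R, 0 < r -> exists c c' : R,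
      [/\ 0 < c, 0 < c' & forall v, r <= `|v| <= r' -> c <= w v <= c']].
Proof.
move=> rho1 rhoq Bunit Brho [delta [phi [delta_small]]].
move=> [smooth_phi phi_ge0 supp_phi _ _] wE w0.
have phiC : continuous phi by exact: (smooth_phi [::]).1.
have phi_supp x : phi x != 0 -> enorm x < delta.
  by move=> px; apply: supp_phi; exact: subset_closure.
split=> [|x|r r' r0]; first exact/w0.
  apply: EFin_inj; rewrite EFinM !wE.
  exact: (pseudo_norm_series_mulmx rho1 rhoq).
have [c c0 cw] : exists2 c : R, 0 < c &
    forall v, [set v : 'cV[R]_d.+1 | r <= `|v| <= r'] v -> c <= w v.
  apply: locally_bounded_below_compact (@closed_annulus_compact R d r r') _.
  move=> v /andP[rv _].
  have v0 : v != 0 by rewrite -normr_gt0 (lt_le_trans r0).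
  have [|c c0 cv] := pseudo_norm_series_gt0_near rho1 rhoq phiC phi_ge0 (v := v).
    rewrite -wE lte_fin lt_neqAle eq_sym; apply/andP; split.
      by apply: contraNneq v0 => /w0 ->.
    rewrite -lee_fin wE (pseudo_norm_seriesE rho1 rhoq).
    by apply: esum_ge0 => n _; exact: series_term_ge0.
  by exists c => //; apply: filterS cv => x; rewrite -wE lee_fin.
have [c' c'w] := pseudo_norm_series_bounded rho1 rhoq Bunit Brho phiC phi_ge0
  delta_small phi_supp r' r0.
exists c, (`|c'| + 1); split; [exact: c0|by rewrite ltr_wpDl|move=> v rv].
rewrite cw//=; have := c'w v rv; rewrite -wE lee_fin => /le_trans; apply.
by rewrite ler_wpDr// ler_norm.
Qed.

Theorem proposition1p2 (R : realType) (d : nat) (A : 'M[int]_d.+1)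
  (w : 'cV[R]_d.+1 -> R) (E F : set 'cV[R]_d.+1) :
  expanding R A -> pseudo_norm A w -> equal_moduli R A ->
  bounded_set E ->
  w_equivalent w E F -> nearly_equivalent E F.
Proof.
move=> expA pnw eqA bndE.
have [rho [rho1 rhoq Bunit Brho]] := common_modulus expA eqA.
have [w0 wB w_annulus] := pseudo_norm_annulus rho1 rhoq Bunit Brho pnw.
exact: (nearly_equivalent_of_w Bunit rho1 Brho w0 wB w_annulus bndE).
Qed.
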